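(* Let $G$ be a simple, simply connected algebraic group over $\mathbb{Q}$ with positive real rank and finite congruence kernel. Let $l$ be a prime number and $t$ a positive integer. Let $c$ be the positive integer such that $\bar H^2(\mathbb{Z}_l)^{\widehat{G(\mathbb{Q})}}\cong \mathbb{Z}_l^c$. Then there is a subgroup of $\bar H^2(\mathbb{Z}/l^t)^{\widehat{G(\mathbb{Q})}}$ isomorphic to $(\mathbb{Z}/l^t)^c$, all of whose elements virtually lift to characteristic zero.
   Context: ''Simple'' means simple over $\mathbb{Q}$; $G$ is not assumed absolutely simple. Positive real rank means that $G(\mathbb{R})$ is not compact. An arithmetic subgroup of $G(\mathbb{Q})$ is a subgroup commensurable with a congruence subgroup. Arithmetic completion and congruence kernel: $\widehat{G(\mathbb{Q})} = \varprojlim_{\Upsilon} G(\mathbb{Q})/\Upsilon$ is the completion of $G(\mathbb{Q})$ with respect to its arithmetic subgroups $\Upsilon$. Let $\mathbb{A}_f$ be the ring of finite adèles of $\mathbb{Q}$; by strong approximation $G(\mathbb{A}_f)$ is the completion of $G(\mathbb{Q})$ with respect to its congruence subgroups. There is a canonical surjective homomorphism $\mathrm{pr}:\widehat{G(\mathbb{Q})}\to G(\mathbb{A}_f)$, and the congruence kernel $\mathrm{Cong}(G)$ is the kernel of $\mathrm{pr}$. $\bar H^2(\mathbb{Z}/l^t) = \varinjlim_{\Upsilon} H^2(\Upsilon,\mathbb{Z}/l^t)$, the direct limit (under restriction maps) over the arithmetic subgroups $\Upsilon$ of $G(\mathbb{Q})$, with trivial action on $\mathbb{Z}/l^t$. The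 conjugation action of $G(\mathbb{Q})$ on this limit extends to a smooth action of $\widehat{G(\mathbb{Q})}$. $\bar H^2(\mathbb{Z}_l) = \varprojlim_t \bar H^2(\mathbb{Z}/l^t)$, with the induced action of $\widehat{G(\mathbb{Q})}$. It is known that, under the stated assumptions on $G$, $\bar H^2(\mathbb{Z}_l)^{\widehat{G(\mathbb{Q})}}$ is isomorphic to $\mathbb{Z}_l^c$ for some positive integer $c$. An element of $\bar H^2(\mathbb{Z}/l^t)$ virtually lifts to characteristic zero if it is in the image of the natural map $\bar H^2(\mathbb{Z}_l)\to\bar H^2(\mathbb{Z}/l^t)$. *)

(* Defs.v *)
From HB Require Import structures.
From mathcomp Require Import all_boot all_order all_algebra all_field.
From mathcomp Require Import ring_quotient.
From mathcomp Require Import all_classical all_reals topology normedtype.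
(* The notations of mpoly clash with those of topology, hence the partial import. *)
From mathcomp Require mpoly.
Import (canonicals, coercions) mpoly.

Set Implicit Arguments.
Unset Strict Implicit.
Unset Printing Implicit Defensive.

Import Order.TTheory GRing.Theory Num.Theory.
Import numFieldNormedType.Exports.

Local Open Scope classical_set_scope.
Local Open Scope ring_scope.

Lemma subr_ACA (V : zmodType) (x y z t : V) : (x - y) - (z - t) = (x - z) - (y - t).
Proof. by rewrite !opprB addrACA [RHS]addrACA [- y - z]addrC. Qed.


(* H^2(Gam, M) for the trivial action, by inhomogeneous cochains. *)
Section GroupCohomology.
Variables (Gam : groupType) (M : zmodType).
Implicit Types s : Gam -> Gam -> M.

Definition is_cocycle2 s := forall g h k : Gam,
  s h k - s (g * h)%g k + s g (h * k)%g - s g h = 0.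

Definition cocycle2 : {pred Gam -> Gam -> M} := fun s => `[< is_cocycle2 s >].

Fact cocycle2_zmod : zmod_closed cocycle2.
Proof.
split=> [|s s' /asboolP hs /asboolP hs']; apply/asboolP => g h k.
  by rewrite subrr add0r subrr.
transitivity ((s h k - s (g * h)%g k + s g (h * k)%g - s g h) -
   (s' h k - s' (g * h)%g k + s' g (h * k)%g - s' g h)); last first.
  by rewrite hs hs' subrr.
rewrite -[(s - s') h k]/(s h k - s' h k).
rewrite -[(s - s') (g * h)%g k]/(s (g * h)%g k - s' (g * h)%g k).
rewrite -[(s - s') g (h * k)%g]/(s g (h * k)%g - s' g (h * k)%g).
rewrite -[(s - s') g h]/(s g h - s' g h).
by rewrite subr_ACA [X in X - _]addrACA -opprD subr_ACA.
Qed.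

HB.instance Definition _ :=
  GRing.isZmodClosed.Build (Gam -> Gam -> M) cocycle2 cocycle2_zmod.

Definition Z2 := {s : Gam -> Gam -> M | s \in cocycle2}.
HB.instance Definition _ := Choice.on Z2.
HB.instance Definition _ := SubType.on Z2.
HB.instance Definition _ := [SubChoice_isSubZmodule of Z2 by <:].

Definition is_coboundary2 s := exists f : Gam -> M,
  forall g h : Gam, s g h = f h - f (g * h)%g + f g.

Definition B2 : {pred Z2} := fun z => `[< is_coboundary2 (val z) >].

Fact B2_zmod : zmod_closed B2.
Proof.
split=> [|s s' /asboolP[f hf] /asboolP[f' hf']]; apply/asboolP.
  by exists (fun=> 0) => g h; rewrite subrr addr0.
exists (fun x => f x - f' x) => g h.
rewrite -[val (s - s') g h]/(val s g h - val s' g h) hf hf'.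
by rewrite [in RHS]subr_ACA [in RHS]addrACA -opprD.
Qed.

HB.instance Definition _ := GRing.isZmodClosed.Build Z2 B2 B2_zmod.

Definition H2 : Type := Quotient.quot B2.
HB.instance Definition _ := GRing.Zmodule.on H2.

Definition H2class (z : Z2) : H2 := (\pi_(Quotient.quot B2) z)%qT.

Lemma H2class_is_additive : zmod_morphism H2class.
Proof. by move=> s s'; rewrite /H2class raddfB. Qed.
HB.instance Definition _ := GRing.isZmodMorphism.Build Z2 H2 H2class H2class_is_additive.

Lemma H2class_surj (a : H2) : exists z, a = H2class z.
Proof. by exists (repr a); rewrite /H2class reprK. Qed.

Lemma H2class_eq (z z' : Z2) :
  H2class z = H2class z' <-> is_coboundary2 (val z - val z').
Proof.
split=> [/eqP|].
  by rewrite /H2class -Quotient.idealrBE => /asboolP.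
by move=> h; apply/eqP; rewrite /H2class -Quotient.idealrBE; apply/asboolP.
Qed.
End GroupCohomology.

(* (f, u) acts on cocycles by s |-> ((x, y) |-> u (s (f x) (f y))): restriction,
   conjugation and change of coefficients are all instances of H2map. *)
Section Functoriality.
Variables (Del Gam : groupType) (M N : zmodType).
Variables (f : {multiplicative Del -> Gam}) (u : {additive M -> N}).

Fact pull2_subproof (z : Z2 Gam M) :
  (fun x y => u (val z (f x) (f y))) \in @cocycle2 Del N.
Proof.
apply/asboolP => x y w; have /asboolP h := valP z.
by rewrite !gmulfM -raddfB -raddfD -raddfB h raddf0.
Qed.
Definition pull2 (z : Z2 Gam M) : Z2 Del N :=
  exist (fun s => s \in @cocycle2 Del N) _ (pull2_subproof z).

Definition H2map (a : H2 Gam M) : H2 Del N := H2class (pull2 (repr a)).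

Lemma H2mapE z : H2map (H2class z) = H2class (pull2 z).
Proof.
have [z' e] : exists z', H2class z' = H2class z /\ z' = repr (H2class z).
  by exists (repr (H2class z)); split=> //; rewrite /H2class reprK.
rewrite /H2map -e.2; apply/H2class_eq.
have /H2class_eq[p hp] := e.1; exists (u \o p \o f) => x y.
rewrite /= gmulfM -raddfB -raddfD -hp raddfB.
by [].
Qed.

Fact H2map_is_additive : zmod_morphism H2map.
Proof.
move=> a b; have [z ->] := H2class_surj a; have [w ->] := H2class_surj b.
rewrite -raddfB !H2mapE -raddfB; congr H2class; apply/val_inj/funext => x.
by apply/funext => y; apply: raddfB u _ _.
Qed.
HB.instance Definition _ :=
  GRing.isZmodMorphism.Build (H2 Gam M) (H2 Del N) H2map H2map_is_additive.
End Functoriality.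

Lemma H2map_eq (Del Gam : groupType) (M N : zmodType)
  (f f' : {multiplicative Del -> Gam}) (u u' : {additive M -> N}) :
  f =1 f' -> u =1 u' -> H2map f u =1 H2map f' u'.
Proof.
move=> ef eu a; have [z ->] := H2class_surj a; rewrite !H2mapE; congr H2class.
by apply/val_inj/funext => x; apply/funext => y; rewrite /= !ef eu.
Qed.

Lemma H2map_comp (Del Gam Eps : groupType) (M N P : zmodType)
  (f : {multiplicative Del -> Gam}) (u : {additive M -> N})
  (g : {multiplicative Eps -> Del}) (v : {additive N -> P})
  (h : {multiplicative Eps -> Gam}) (w : {additive M -> P}) :
  h =1 f \o g -> w =1 v \o u -> forall a, H2map g v (H2map f u a) = H2map h w a.
Proof.
move=> eh ew a; have [z ->] := H2class_surj a; rewrite !H2mapE; congr H2class.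
by apply/val_inj/funext => x; apply/funext => y; rewrite /= !eh ew.
Qed.

Lemma H2map_id (Gam : groupType) (M : zmodType)
    (f : {multiplicative Gam -> Gam}) (u : {additive M -> M}) :
  f =1 id -> u =1 id -> H2map f u =1 id.
Proof.
move=> ef eu a; have [z ->] := H2class_surj a; rewrite !H2mapE; congr H2class.
by apply/val_inj/funext => x; apply/funext => y; rewrite /= !ef eu.
Qed.

Lemma inner_identity (V : zmodType) (a a' b1 b2 b3 b4 b5 b6 b7 b8 : V) :
    a - b1 + b2 - b3 = 0 -> b4 - b1 + b5 - b6 = 0 -> b7 - b8 + b5 - a' = 0 ->
  a - a' = b4 - b7 - (b2 - b8) + (b3 - b6).
Proof.
move=> /eqP + /eqP + /eqP.
rewrite !subr_eq0 => /eqP <- /eqP <- /eqP <-.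
rewrite !opprD !opprK !addrA; congr (_ + _).
rewrite (addrAC _ (- b4) b1) (addrAC _ b2 b1) addrNK.
rewrite (addrAC _ a b2) (addrAC _ b8 b2) addrNK.
by rewrite (addrC b4) (addrAC _ b4 b8) (addrAC _ b4 a) addrK [RHS]addrC addrA.
Qed.

Lemma H2map_inner (Gam : groupType) (M : zmodType)
    (f : {multiplicative Gam -> Gam}) (u : {additive M -> M}) (h : Gam) :
  (forall x, f x = h^-1 * x * h)%g -> u =1 id -> H2map f u =1 id.
Proof.
move=> ef eu a; have [z ->] := H2class_surj a; rewrite !H2mapE.
apply/H2class_eq; have /asboolP cz := valP z.
exists (fun x => val z h (f x) - val z x h) => x y.
have hf t : (h * f t = t * h)%g by rewrite ef !mulgA mulgV mul1g.
have c1 := cz h (f x) (f y); have c2 := cz x h (f y); have c3 := cz x y h.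
rewrite !hf -gmulfM in c1 c2 c3.
rewrite -[(_ - _) x y]/(u (val z (f x) (f y)) - val z x y) eu.
move: c1 c2 c3; set A := val z (f x) (f y); set A' := val z x y.
set b1 := val z (x * h)%g _; set b2 := val z h (f (x * y)%g).
set b3 := val z h (f x); set b4 := val z h (f y).
set b5 := val z x (y * h)%g; set b6 := val z x h.
set b7 := val z y h; set b8 := val z (x * y)%g h.
move=> c1 c2 c3.
exact: inner_identity c1 c2 c3.
Qed.

Record subgroup (G : groupType) := Subgroup {
  sg_mem : G -> bool;
  sg_closed : group_closed (sg_mem : {pred G}) }.
Coercion sg_pred (G : groupType) (U : subgroup G) : {pred G} := sg_mem U.

Section Subgroups.
Variable G : groupType.
Implicit Types U V : subgroup G.

Fact sg_mulg_closed U : mulg_closed U.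
Proof. exact: group_closedM (sg_closed U). Qed.
Fact sg_one U : 1%g \in (U : {pred G}).
Proof. by have [] := sg_closed U. Qed.
Fact sg_invg_closed U : invg_closed U.
Proof. exact: group_closedV (sg_closed U). Qed.
HB.instance Definition _ U := isMulClosed.Build G (sg_pred U) (@sg_mulg_closed U).
HB.instance Definition _ U := isMul1Closed.Build G (sg_pred U) (sg_one U).
HB.instance Definition _ U := isInvClosed.Build G (sg_pred U) (@sg_invg_closed U).

Definition subg U := {x : G | x \in U}.
HB.instance Definition _ U := SubType.on (subg U).
HB.instance Definition _ U := Choice.on (subg U).
HB.instance Definition _ U :=
  SubChoice_isSubGroup.Build G (mem U) (subg U) (sg_closed U).

Section Inclusion.
Variables (U V : subgroup G) (le : {subset V <= U}).
Definition incl (x : subg V) : subg U :=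
  exist (fun y => y \in U) (val x) (le (valP x)).
Fact incl_mul : {morph incl : x y / x * y}%g.
Proof. by move=> x y; apply/val_inj. Qed.
HB.instance Definition _ := isMultiplicative.Build (subg V) (subg U) incl incl_mul.
End Inclusion.

Section Intersection.
Variables U V : subgroup G.
Definition capg_mem (x : G) := (x \in U) && (x \in V).
Fact capg_closed : group_closed (capg_mem : {pred G}).
Proof.
split=> [|x y]; first by apply/andP; rewrite !gpred1.
by move=> /andP[xU xV] /andP[yU yV]; apply/andP; rewrite !gpredF.
Qed.
Definition capg := Subgroup capg_closed.
End Intersection.

Section Conjugation.
Variables (g : G) (U : subgroup G).
(* conjsub g U = g U g^-1, and unconj is x |-> g^-1 x g from g U g^-1 to U. *)
Definition conjsub_mem (x : G) := (g^-1 * x * g)%g \in U.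
Fact conjsub_closed : group_closed (conjsub_mem : {pred G}).
Proof.
split=> [|x y hx hy]; first by rewrite unfold_in /conjsub_mem mulg1 mulVg gpred1.
suff : (g^-1 * (x / y) * g)%g \in U by [].
have -> : (g^-1 * (x / y) * g = (g^-1 * x * g) / (g^-1 * y * g))%g.
  by rewrite !invgM invgK !mulgA mulgK.
exact: gpredF.
Qed.
Definition conjsub := Subgroup conjsub_closed.

Lemma conjsubE x : (x \in conjsub) = ((g^-1 * x * g)%g \in U).
Proof. by []. Qed.

Fact unconj_subproof (x : subg conjsub) : (g^-1 * val x * g)%g \in U.
Proof. exact: valP x. Qed.
Definition unconj (x : subg conjsub) : subg U :=
  exist (fun y => y \in U) _ (unconj_subproof x).
Fact unconj_mul : {morph unconj : x y / x * y}%g.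
Proof.
move=> x y; apply/val_inj.
rewrite -[LHS]/(g^-1 * (val x * val y) * g)%g.
rewrite -[RHS]/((g^-1 * val x * g) * (g^-1 * val y * g))%g.
by rewrite !mulgA mulgK.
Qed.
HB.instance Definition _ :=
  isMultiplicative.Build (subg conjsub) (subg U) unconj unconj_mul.
End Conjugation.

Definition lcoset (g : G) U : set G := [set (g * u)%g | u in [set u | u \in U]].
End Subgroups.
Arguments unconj {G} g U x.

(* ds_map does not depend on the proof of i <= j, by ds_map_comp and ds_map_id. *)
Record dirsys (I : Type) := Dirsys {
  ds_le : I -> I -> Prop;
  ds_obj :> I -> zmodType;
  ds_map : forall i j, ds_le i j -> {additive ds_obj i -> ds_obj j};
  ds_refl : forall i, ds_le i i;
  ds_trans : forall i j k, ds_le i j -> ds_le j k -> ds_le i k;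
  ds_directed : forall i j, exists k, ds_le i k /\ ds_le j k;
  ds_inhab : exists i : I, True;
  ds_map_id : forall i (h : ds_le i i) a, ds_map h a = a;
  ds_map_comp : forall i j k (h : ds_le i j) (h' : ds_le j k) (h'' : ds_le i k) a,
    ds_map h' (ds_map h a) = ds_map h'' a }.

Section DirectLimit.
Variables (I : Type) (A : dirsys I).

Definition germ := {i : I & A i}.
HB.instance Definition _ := gen_eqMixin germ.
HB.instance Definition _ := gen_choiceMixin germ.

Definition germ_eqv (a b : germ) : Prop :=
  exists k (h : ds_le A (tag a) k) (h' : ds_le A (tag b) k),
    ds_map h (tagged a) = ds_map h' (tagged b).

Definition germ_rel : rel germ := fun a b => `[< germ_eqv a b >].

Lemma germ_eqv_trans a b c : germ_eqv a b -> germ_eqv b c -> germ_eqv a c.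
Proof.
move=> [k [h [h' e]]] [l [p [p' e']]].
have [m [hm pm]] := ds_directed A k l.
exists m, (ds_trans h hm), (ds_trans p' pm).
rewrite -(ds_map_comp h hm) e (ds_map_comp _ _ (ds_trans p pm)).
by rewrite -(ds_map_comp p pm) e' (ds_map_comp _ _ (ds_trans p' pm)).
Qed.

Fact germ_equiv_class : equiv_class_of germ_rel.
Proof.
split=> [a|a b|b a c].
- by apply/asboolP; exists (tag a), (ds_refl _ _), (ds_refl _ _).
- by apply/asboolP/asboolP => -[k [h [h' e]]]; exists k, h', h.
- by move=> /asboolP ab /asboolP bc; apply/asboolP/(germ_eqv_trans ab bc).
Qed.
Canonical germ_equiv := EquivRelPack germ_equiv_class.

Definition dirlim := {eq_quot germ_rel}%qT.
HB.instance Definition _ := Choice.on dirlim.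

Definition dl_in i (a : A i) : dirlim := (\pi_dirlim (existT _ i a : germ))%qT.

Lemma dl_in_eq i j (a : A i) (b : A j) :
  dl_in a = dl_in b <->
  exists k (h : ds_le A i k) (h' : ds_le A j k), ds_map h a = ds_map h' b.
Proof.
split=> [/eqP|h]; rewrite /dl_in.
  by rewrite eqmodE => /asboolP.
by apply/eqP; rewrite eqmodE; apply/asboolP.
Qed.

Lemma dl_in_map i j (h : ds_le A i j) (a : A i) : dl_in (ds_map h a) = dl_in a.
Proof.
apply/dl_in_eq; exists j, (ds_refl _ _), h.
by rewrite ds_map_id.
Qed.

Lemma dl_in_repr (u : dirlim) : dl_in (tagged (repr u)) = u.
Proof. by rewrite -[RHS]reprK /dl_in; case: (repr _). Qed.

Lemma dl_in_surj (u : dirlim) : exists i (a : A i), u = dl_in a.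
Proof.
by exists (tag (repr u)), (tagged (repr u)); rewrite dl_in_repr.
Qed.

Lemma dl_in_surj2 (u v : dirlim) :
  exists i (a b : A i), u = dl_in a /\ v = dl_in b.
Proof.
have [i [a ->]] := dl_in_surj u; have [j [b ->]] := dl_in_surj v.
have [k [h h']] := ds_directed A i j.
by exists k, (ds_map h a), (ds_map h' b); rewrite !dl_in_map.
Qed.

Lemma dl_in_surj3 (u v w : dirlim) :
  exists i (a b c : A i), [/\ u = dl_in a, v = dl_in b & w = dl_in c].
Proof.
have [i [a [b [-> ->]]]] := dl_in_surj2 u v; have [j [c ->]] := dl_in_surj w.
have [k [h h']] := ds_directed A i j.
by exists k, (ds_map h a), (ds_map h b), (ds_map h' c); rewrite !dl_in_map.
Qed.

Definition dl_zero : dirlim :=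
  dl_in (0 : A (sval (cid (ds_inhab A)))).
Definition dl_opp (u : dirlim) : dirlim := dl_in (- tagged (repr u)).
Definition dl_add (u v : dirlim) : dirlim :=
  let a := tagged (repr u) in let b := tagged (repr v) in
  let: exist k (conj h h') := cid (ds_directed A (tag (repr u)) (tag (repr v))) in
  dl_in (ds_map h a + ds_map h' b).

Lemma dl_zeroE i : dl_zero = dl_in (0 : A i).
Proof.
rewrite /dl_zero; case: (cid _) => j /= _; apply/dl_in_eq.
have [k [h h']] := ds_directed A j i.
by exists k, h, h'; rewrite !raddf0.
Qed.

Lemma dl_oppE i (a : A i) : dl_opp (dl_in a) = dl_in (- a).
Proof.
rewrite /dl_opp; have /dl_in_eq[k [h [h' e]]] := dl_in_repr (dl_in a).
by apply/dl_in_eq; exists k, h, h'; rewrite !raddfN e.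
Qed.

Lemma dl_addE i (a b : A i) : dl_add (dl_in a) (dl_in b) = dl_in (a + b).
Proof.
rewrite /dl_add; case: (cid _) => k [h h'].
have /dl_in_eq[l [p [p' e]]] := dl_in_repr (dl_in a).
have /dl_in_eq[m [q [q' e']]] := dl_in_repr (dl_in b).
have [n [kn ln]] := ds_directed A k l.
have [o [no mo]] := ds_directed A n m.
have ko := ds_trans kn no; have lo := ds_trans ln no.
apply/dl_in_eq; exists o, ko, (ds_trans p' lo).
rewrite !raddfD; congr (_ + _).
  rewrite (ds_map_comp _ _ (ds_trans p lo)) -(ds_map_comp p lo) e.
  exact: ds_map_comp.
rewrite (ds_map_comp _ _ (ds_trans q mo)) -(ds_map_comp q mo) e'.
exact: ds_map_comp.
Qed.

Fact dl_addA : associative dl_add.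
Proof.
by move=> u v w; have [i [a [b [c [-> -> ->]]]]] := dl_in_surj3 u v w;
  rewrite !dl_addE addrA.
Qed.
Fact dl_addC : commutative dl_add.
Proof.
by move=> u v; have [i [a [b [-> ->]]]] := dl_in_surj2 u v;
  rewrite !dl_addE addrC.
Qed.
Fact dl_add0 : left_id dl_zero dl_add.
Proof.
by move=> u; have [i [a ->]] := dl_in_surj u;
  rewrite (dl_zeroE i) dl_addE add0r.
Qed.
Fact dl_addN : left_inverse dl_zero dl_opp dl_add.
Proof.
by move=> u; have [i [a ->]] := dl_in_surj u;
  rewrite (dl_zeroE i) dl_oppE dl_addE addNr.
Qed.
HB.instance Definition _ :=
  GRing.isZmodule.Build dirlim dl_addA dl_addC dl_add0 dl_addN.

Fact dl_in_is_additive i : zmod_morphism (@dl_in i).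
Proof. by move=> a b; rewrite -dl_addE -dl_oppE. Qed.
HB.instance Definition _ i :=
  GRing.isZmodMorphism.Build (A i) dirlim (@dl_in i) (@dl_in_is_additive i).
End DirectLimit.

Section DirectLimitMap.
Variables (I J : Type) (A : dirsys I) (B : dirsys J).
Variables (phi : I -> J) (psi : forall i, {additive A i -> B (phi i)}).

Definition dl_map_compat := forall i j (h : ds_le A i j) a,
  dl_in (psi j (ds_map h a)) = dl_in (psi i a).

Definition dl_map (u : dirlim A) : dirlim B :=
  dl_in (psi (tag (repr u)) (tagged (repr u))).

Lemma dl_mapE (c : dl_map_compat) i (a : A i) :
  dl_map (dl_in a) = dl_in (psi i a).
Proof.
rewrite /dl_map; have /dl_in_eq[k [h [h' e]]] := dl_in_repr (dl_in a).
by rewrite -(c _ _ h) e c.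
Qed.
End DirectLimitMap.

Lemma dl_map_is_additive (I J : Type) (A : dirsys I) (B : dirsys J)
   (phi : I -> J) (psi : forall i, {additive A i -> B (phi i)}) :
  dl_map_compat psi -> zmod_morphism (dl_map psi).
Proof.
move=> c u v; have [i [a [b [-> ->]]]] := dl_in_surj2 u v.
by rewrite -raddfB !dl_mapE // !raddfB.
Qed.

Section InverseLimit.
Variables (A : nat -> zmodType) (p : forall t, {additive A t.+1 -> A t}).

Definition coherent : {pred forall t, A t} :=
  fun x => `[< forall t, p t (x t.+1) = x t >].
Definition invlim := {x : forall t, A t | x \in coherent}.
HB.instance Definition _ := SubType.on invlim.
HB.instance Definition _ := Choice.on invlim.

Definition il_pr t (x : invlim) : A t := val x t.

Lemma il_coh (x : invlim) t : p t (il_pr t.+1 x) = il_pr t x.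
Proof. by have /asboolP := valP x; apply. Qed.

Lemma invlimP (x y : invlim) : (forall t, il_pr t x = il_pr t y) -> x = y.
Proof. by move=> h; apply/val_inj/functional_extensionality_dep. Qed.

Fact il_mk_subproof (x : forall t, A t) (h : forall t, p t (x t.+1) = x t) :
  x \in coherent.
Proof. exact/asboolP. Qed.
Definition il_mk x h : invlim := exist (fun y => y \in coherent) x (il_mk_subproof h).

Fact il_add_subproof (x y : invlim) t :
  p t (il_pr t.+1 x + il_pr t.+1 y) = il_pr t x + il_pr t y.
Proof. by rewrite raddfD !il_coh. Qed.
Fact il_opp_subproof (x : invlim) t : p t (- il_pr t.+1 x) = - il_pr t x.
Proof. by rewrite raddfN il_coh. Qed.
Fact il_zero_subproof t : p t 0 = 0. Proof. exact: raddf0. Qed.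
Definition il_add x y : invlim := il_mk (il_add_subproof x y).
Definition il_opp x : invlim := il_mk (il_opp_subproof x).
Definition il_zero : invlim := il_mk il_zero_subproof.
Fact il_addA : associative il_add.
Proof. by move=> x y z; apply/invlimP => t; rewrite /il_pr /= addrA. Qed.
Fact il_addC : commutative il_add.
Proof. by move=> x y; apply/invlimP => t; rewrite /il_pr /= addrC. Qed.
Fact il_add0 : left_id il_zero il_add.
Proof. by move=> x; apply/invlimP => t; rewrite /il_pr /= add0r. Qed.
Fact il_addN : left_inverse il_zero il_opp il_add.
Proof. by move=> x; apply/invlimP => t; rewrite /il_pr /= addNr. Qed.
HB.instance Definition _ :=
  GRing.isZmodule.Build invlim il_addA il_addC il_add0 il_addN.
Fact il_pr_is_additive t : zmod_morphism (il_pr t).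
Proof. by []. Qed.
HB.instance Definition _ t :=
  GRing.isZmodMorphism.Build invlim (A t) (il_pr t) (il_pr_is_additive t).
End InverseLimit.

Record subgroup_family (G : groupType) := SubgroupFamily {
  family_mem :> subgroup G -> Prop;
  family_inhab : exists U, family_mem U;
  family_cap : forall U V, family_mem U -> family_mem V -> family_mem (capg U V);
  family_conj : forall g U, family_mem U -> family_mem (conjsub g U) }.

Definition fam_index (G : groupType) (P : subgroup G -> Prop) := {U | P U}.

Section Completion.
Variables (G : groupType) (P : subgroup G -> Prop).
Implicit Types U V : fam_index P.

(* An element of the inverse limit of the coset spaces G / U is represented by the
   family of cosets themselves, seen as subsets of G; the transition maps send a
   coset of V to the coset of U that contains it, for V a subgroup of U. *)
Definition is_coset_family (x : fam_index P -> set G) :=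
  (forall U, exists g, x U = lcoset g (sval U)) /\
  (forall U V, {subset sval V <= sval U} -> x V `<=` x U).
Definition completion := {x : fam_index P -> set G | is_coset_family x}.

Definition cpl_at (x : completion) U : set G := sval x U.

Fact cpl_one_subproof : is_coset_family (fun U => lcoset 1%g (sval U)).
Proof.
split=> [U|U V h]; first by exists 1%g.
by move=> _ [v vV <-]; exists v => //; apply: h.
Qed.
Definition cpl_one : completion := exist _ _ cpl_one_subproof.

Fact cpl_nonempty (x : completion) U : exists g, cpl_at x U g.
Proof.
have [g e] := (svalP x).1 U; exists g; rewrite /cpl_at e.
by exists 1%g; [exact: gpred1 | rewrite mulg1].
Qed.
Definition cpl_rep (x : completion) U : G := sval (cid (cpl_nonempty x U)).

End Completion.
Arguments cpl_one {G} P.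

Section Projection.
Variables (G : groupType) (P P' : subgroup G -> Prop).
Variable P'P : forall U, P' U -> P U.
Definition cpl_sub (U : fam_index P') : fam_index P := exist _ (sval U) (P'P (svalP U)).
Fact cpl_pr_subproof (x : completion P) :
  is_coset_family (fun U : fam_index P' => cpl_at x (cpl_sub U)).
Proof.
split=> [U|U V h]; first exact: (svalP x).1 (cpl_sub U).
exact: (svalP x).2 (cpl_sub U) (cpl_sub V) h.
Qed.
Definition cpl_pr (x : completion P) : completion P' := exist _ _ (cpl_pr_subproof x).
End Projection.

Section Family.
Variables (G : groupType) (F : subgroup_family G).

Local Notation idx := (fam_index F).
Implicit Types U V : idx.

Definition fam_conj (g : G) U : idx :=
  exist _ (conjsub g (sval U)) (family_conj g (svalP U)).

(* U precedes V when V is contained in U. *)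
Definition H2_le U V := {subset sval V <= sval U}.

Section Coefficients.
Variable M : zmodType.

Definition H2_res U V (h : H2_le U V) :
  {additive H2 (subg (sval U)) M -> H2 (subg (sval V)) M} := H2map (incl h) idfun.

Fact H2_le_refl U : H2_le U U. Proof. by []. Qed.
Fact H2_le_trans U V W : H2_le U V -> H2_le V W -> H2_le U W.
Proof. by move=> h h' x /h' /h. Qed.
Fact H2_directed U V : exists W, H2_le U W /\ H2_le V W.
Proof.
exists (exist _ (capg (sval U) (sval V)) (family_cap (svalP U) (svalP V))).
by split=> x /andP[].
Qed.
Fact H2_inhab : exists U : idx, True.
Proof. by have [U FU] := family_inhab F; exists (exist _ U FU). Qed.
Fact H2_res_id U (h : H2_le U U) a : H2_res h a = a.
Proof. by apply: H2map_id => x //; apply/val_inj. Qed.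
Fact H2_res_comp U V W (h : H2_le U V) (h' : H2_le V W) (h'' : H2_le U W) a :
  H2_res h' (H2_res h a) = H2_res h'' a.
Proof. by apply: H2map_comp => x //; apply/val_inj. Qed.

Definition H2_system : dirsys idx :=
  Dirsys H2_le_refl H2_le_trans H2_directed H2_inhab H2_res_id H2_res_comp.

Definition Hbar2 := dirlim H2_system.
HB.instance Definition _ := GRing.Zmodule.on Hbar2.

Definition Hbar2_in U (a : H2 (subg (sval U)) M) : Hbar2 :=
  @dl_in _ H2_system U a.

Fact Hbar2_in_is_additive U : zmod_morphism (@Hbar2_in U).
Proof. exact: (@dl_in_is_additive _ H2_system). Qed.
HB.instance Definition _ U := GRing.isZmodMorphism.Build
  (H2 (subg (sval U)) M) Hbar2 (@Hbar2_in U) (@Hbar2_in_is_additive U).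

Lemma Hbar2_surj (u : Hbar2) :
  exists U (a : H2 (subg (sval U)) M), u = Hbar2_in a.
Proof. exact: (@dl_in_surj _ H2_system). Qed.

Lemma Hbar2_surj2 (u v : Hbar2) : exists U (a b : H2 (subg (sval U)) M),
  u = Hbar2_in a /\ v = Hbar2_in b.
Proof. exact: (@dl_in_surj2 _ H2_system). Qed.

Definition H2_conj (g : G) U :
    {additive H2 (subg (sval U)) M -> H2 (subg (sval (fam_conj g U))) M} :=
  H2map (unconj g (sval U)) idfun.

Definition gact (g : G) : Hbar2 -> Hbar2 :=
  @dl_map _ _ H2_system H2_system (fam_conj g) (H2_conj g).

Lemma Hbar2_in_res U V (h : H2_le U V) (a : H2 (subg (sval U)) M) :
  Hbar2_in (H2_res h a) = Hbar2_in a.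
Proof. exact: (@dl_in_map _ H2_system). Qed.

Lemma gactE g U (a : H2 (subg (sval U)) M) :
  gact g (Hbar2_in a) = Hbar2_in (H2_conj g U a).
Proof.
apply: dl_mapE => {}U V h {}a.
have h' : H2_le (fam_conj g U) (fam_conj g V) by move=> x; apply: h.
rewrite -[RHS](Hbar2_in_res h'); congr Hbar2_in.
rewrite [LHS](H2map_comp (h := incl h \o unconj g (sval V)) (w := idfun)) //.
by rewrite [RHS](H2map_comp (h := incl h \o unconj g (sval V)) (w := idfun)) //
  => x; apply/val_inj.
Qed.

Fact gact_is_additive g : zmod_morphism (gact g).
Proof.
move=> u v; have [U [a [b [-> ->]]]] := Hbar2_surj2 u v.
by rewrite -[Hbar2_in a - _]raddfB !gactE !raddfB.
Qed.
HB.instance Definition _ g :=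
  GRing.isZmodMorphism.Build Hbar2 Hbar2 (gact g) (gact_is_additive g).

Lemma gactM g h u : gact (g * h)%g u = gact g (gact h u).
Proof.
have [U [a ->]] := Hbar2_surj u; rewrite !gactE.
have e : H2_le (fam_conj (g * h)%g U) (fam_conj g (fam_conj h U)).
  by move=> x; rewrite !conjsubE invgM !mulgA.
rewrite -(Hbar2_in_res e); congr Hbar2_in.
rewrite [LHS](H2map_comp (h := unconj h (sval U) \o unconj g (sval (fam_conj h U)))
   (w := idfun)) //; last first.
  by move=> x; apply/val_inj; rewrite /= invgM !mulgA.
by rewrite [RHS](H2map_comp
  (h := unconj h (sval U) \o unconj g (sval (fam_conj h U))) (w := idfun)).
Qed.

Lemma gact_inner U (a : H2 (subg (sval U)) M) g :
  g \in sval U -> gact g (Hbar2_in a) = Hbar2_in a.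
Proof.
move=> gU; rewrite gactE.
have e : H2_le (fam_conj g U) U.
  by move=> x xU; rewrite conjsubE !(gpredM, gpredV).
rewrite -(Hbar2_in_res e); congr Hbar2_in.
rewrite [LHS](H2map_comp (h := unconj g (sval U) \o incl e) (w := idfun)) //.
by apply: (@H2map_inner _ _ _ _ (exist (fun y => y \in sval U) g gU : subg _))
  => // x; apply/val_inj.
Qed.
End Coefficients.

(* x in the completion acts on the image of H^2(U) through any g in the coset x_U;
   the independence of U and g is cactE. *)
Definition cact (M : zmodType) (x : completion F) (u : Hbar2 M) : Hbar2 M :=
  gact (cpl_rep x (tag (repr u))) u.

Lemma cactE (M : zmodType) (x : completion F) U (a : H2 (subg (sval U)) M) g :
  cpl_at x U g -> cact x (Hbar2_in a) = gact g (Hbar2_in a).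
Proof.
rewrite /cact; move: (svalP (cid (cpl_nonempty x (tag (repr (Hbar2_in a)))))).
rewrite -/(cpl_rep x _); set r := cpl_rep _ _ => hr hg.
have key V (b : H2 (subg (sval V)) M) W s t : Hbar2_in b = Hbar2_in a ->
    H2_le V W -> cpl_at x V s -> cpl_at x W t ->
    gact s (Hbar2_in a) = gact t (Hbar2_in a).
  move=> <- VW xs xt; have {xt} := (svalP x).2 _ _ VW _ xt.
  move: xs; rewrite /cpl_at; have [g0 ->] := (svalP x).1 V.
  move=> [v vV <-] [w wV <-]; rewrite !gactM.
  by rewrite (gact_inner b vV) (gact_inner b wV).
have [W [hW hW']] := H2_directed (tag (repr (Hbar2_in a))) U.
have [t ht] := cpl_nonempty x W.
rewrite (key _ (tagged (repr (Hbar2_in a))) W r t) //; last exact: dl_in_repr.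
by rewrite (key U a W g t).
Qed.

Section CoefMap.
Variables (M N : zmodType) (u : {additive M -> N}).
Definition H2_coef U : {additive H2 (subg (sval U)) M -> H2 (subg (sval U)) N} :=
  H2map idfun u.
Definition Hbar2_coef : Hbar2 M -> Hbar2 N :=
  @dl_map _ _ (H2_system M) (H2_system N) id H2_coef.

Lemma Hbar2_coefE U (a : H2 (subg (sval U)) M) :
  Hbar2_coef (Hbar2_in a) = Hbar2_in (H2_coef U a).
Proof.
apply: (@dl_mapE _ _ (H2_system M) (H2_system N)) => {}U V h {}a.
rewrite -[RHS](@Hbar2_in_res N _ _ h); congr Hbar2_in.
rewrite [LHS](H2map_comp (h := incl h) (w := u)) //.
by rewrite [RHS](H2map_comp (h := incl h) (w := u)).
Qed.

Fact Hbar2_coef_is_additive : zmod_morphism Hbar2_coef.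
Proof.
move=> v w; have [U [a [b [-> ->]]]] := Hbar2_surj2 v w.
by rewrite -[Hbar2_in a - _]raddfB !Hbar2_coefE !raddfB.
Qed.
HB.instance Definition _ := GRing.isZmodMorphism.Build (Hbar2 M) (Hbar2 N)
  Hbar2_coef Hbar2_coef_is_additive.

Lemma cact_coef x v : Hbar2_coef (cact x v) = cact x (Hbar2_coef v).
Proof.
have [U [a ->]] := Hbar2_surj v.
have [g hg] := cpl_nonempty x U.
rewrite Hbar2_coefE !(cactE _ hg) !gactE Hbar2_coefE; congr Hbar2_in.
rewrite [LHS](H2map_comp (h := unconj g (sval U)) (w := u)) //.
by rewrite [RHS](H2map_comp (h := unconj g (sval U)) (w := u)).
Qed.
End CoefMap.
End Family.
Arguments Hbar2_coef {G} F {M N} u v.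

(* Linear algebraic groups over Q are treated classically: Zariski closed subgroups of
   GL_n over algC cut out by polynomials with rational coefficients. In characteristic 0
   group schemes are reduced and every affine algebraic group embeds in some GL_n.
   The variables are the n * n matrix entries and the inverse of the determinant. *)
Notation polyGL n K := (mpoly.mpoly (n * n + 1) K).

Definition coordGL (n : nat) (K : fieldType) (g : 'M[K]_n) : 'I_(n * n + 1) -> K :=
  row_mx (mxvec g) ((\det g)^-1)%:M 0.

Definition evalGL (n : nat) (K : numFieldType) (p : polyGL n rat) (g : 'M[K]_n) : K :=
  mpoly.mmap (ratr : rat -> K) (coordGL g) p.

Definition pointsGL (n : nat) (E : set (polyGL n rat)) (K : numFieldType) :
    set 'M[K]_n :=
  [set g | g \in unitmx /\ forall p, E p -> evalGL p g = 0].

Arguments pointsGL {n} E K _.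

Record algGroup (n : nat) := AlgGroup {
  alg_eqs : set (polyGL n rat);
  alg_one : pointsGL alg_eqs algC 1%:M;
  alg_mul : forall g h : 'M[algC]_n,
    pointsGL alg_eqs algC g -> pointsGL alg_eqs algC h ->
    pointsGL alg_eqs algC (g *m h);
  alg_inv : forall g : 'M[algC]_n,
    pointsGL alg_eqs algC g -> pointsGL alg_eqs algC (invmx g) }.

Definition points n (G : algGroup n) (K : numFieldType) : set 'M[K]_n :=
  pointsGL (alg_eqs G) K.

Arguments points {n} G K _.

Definition zariski_closed n (S : set (polyGL n algC)) : set 'M[algC]_n :=
  [set g | forall p, S p -> mpoly.meval (coordGL g) p = 0].

(* Zariski connectedness of the set of algC-points. *)
Definition connected_group n (G : algGroup n) :=
  forall S T : set (polyGL n algC),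
    points G algC `<=` zariski_closed S `|` zariski_closed T ->
    points G algC `&` (zariski_closed S `&` zariski_closed T) = set0 ->
  points G algC `<=` zariski_closed S \/ points G algC `<=` zariski_closed T.

Definition commutative_group n (G : algGroup n) :=
  forall g h, points G algC g -> points G algC h -> g *m h = h *m g.

Definition normal_in n (N G : algGroup n) :=
  points N algC `<=` points G algC /\
  forall g h, points G algC g -> points N algC h ->
    points N algC (g *m h *m invmx g).

(* Simple over Q (also called almost simple): connected, not commutative, and every normal
   algebraic subgroup defined over Q is finite or everything. A nontrivial radical
   would be such a subgroup, so G is semisimple. *)
Definition simple_group n (G : algGroup n) :=
  [/\ connected_group G, ~ commutative_group G &
      forall N : algGroup n, normal_in N G ->
        finite_set (points N algC) \/ points N algC = points G algC].

Definition alg_morphism m n (H : algGroup m) (G : algGroup n)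
    (f : 'M[algC]_m -> 'M[algC]_n) :=
  [/\ forall g, points H algC g -> points G algC (f g),
      forall g h, points H algC g -> points H algC h -> f (g *m h) = f g *m f h &
      exists P : 'I_n -> 'I_n -> polyGL m rat,
        forall g, points H algC g -> forall i j, f g i j = evalGL (P i j) g].

Definition isogeny m n (H : algGroup m) (G : algGroup n) f :=
  [/\ alg_morphism H G f,
      forall g, points G algC g -> exists2 h, points H algC h & f h = g &
      finite_set [set h | points H algC h /\ f h = 1%:M]].

Definition alg_isomorphism m n (H : algGroup m) (G : algGroup n) f :=
  alg_morphism H G f /\
  exists f' : 'M[algC]_n -> 'M[algC]_m,
    [/\ alg_morphism G H f',
        forall h, points H algC h -> f' (f h) = h &
        forall g, points G algC g -> f (f' g) = g].

(* In characteristic 0 every isogeny of connected groups is central. *)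
Definition simply_connected n (G : algGroup n) :=
  forall m (H : algGroup m) (f : 'M[algC]_m -> 'M[algC]_n),
    connected_group H -> isogeny H G f -> alg_isomorphism H G f.

(* Compactness does not depend on whether G(R) is viewed in GL_n(R) or in M_n(R). *)
Definition positive_real_rank (R : realType) n (G : algGroup n) :=
  ~ compact (points G R : set 'M[R]_n).

Section RationalPoints.
Variables (n : nat) (G : algGroup n).

Lemma eval_ratr (p : polyGL n rat) (g : 'M[rat]_n) :
  evalGL p (map_mx (ratr : rat -> algC) g) = ratr (evalGL p g).
Proof.
have hc i : coordGL (map_mx (ratr : rat -> algC) g) i = ratr (coordGL g i).
  rewrite /coordGL -(splitK i) det_map_mx; case: (fintype.split i) => j /=.
    by rewrite !row_mxEl -map_mxvec mxE.
  by rewrite !row_mxEr !ord1 !mxE fmorphV.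
rewrite /evalGL /mpoly.mmap rmorph_sum; apply: eq_bigr => m _ /=.
rewrite rmorphM /= fmorph_rat; congr (_ * _).
rewrite /mpoly.mmap1 rmorph_prod; apply: eq_bigr => i _.
by rewrite hc rmorphXn.
Qed.

Lemma points_ratr (g : 'M[rat]_n) :
  points G rat g <-> points G algC (map_mx (ratr : rat -> algC) g).
Proof.
split=> -[gu ge]; split.
- by rewrite map_unitmx.
- by move=> p Ep; rewrite eval_ratr ge // rmorph0.
- by rewrite -(map_unitmx (ratr : {rmorphism rat -> algC})).
- move=> p /ge; rewrite eval_ratr => /eqP; rewrite fmorph_eq0 => /eqP.
  by [].
Qed.

Definition ratpts := {g : 'M[rat]_n | `[< points G rat g >]}.
HB.instance Definition _ := SubType.on ratpts.
HB.instance Definition _ := Choice.on ratpts.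

Fact ratpts_one_subproof : `[< points G rat 1%:M >].
Proof. by apply/asboolP/points_ratr; rewrite map_mx1; exact: alg_one. Qed.
Fact ratpts_mul_subproof (g h : ratpts) : `[< points G rat (val g *m val h) >].
Proof.
have /asboolP/points_ratr hg := valP g; have /asboolP/points_ratr hh := valP h.
by apply/asboolP/points_ratr; rewrite map_mxM; exact: alg_mul.
Qed.
Fact ratpts_inv_subproof (g : ratpts) : `[< points G rat (invmx (val g)) >].
Proof.
have /asboolP/points_ratr hg := valP g.
by apply/asboolP/points_ratr; rewrite map_invmx; exact: alg_inv.
Qed.
Definition ratpts_one :
  ratpts := exist (fun g => `[< points G rat g >]) _ ratpts_one_subproof.
Definition ratpts_mul (g h : ratpts) :
  ratpts := exist (fun g => `[< points G rat g >]) _ (ratpts_mul_subproof g h).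
Definition ratpts_inv (g : ratpts) :
  ratpts := exist (fun g => `[< points G rat g >]) _ (ratpts_inv_subproof g).

Lemma ratpts_unit (g : ratpts) : val g \in unitmx.
Proof. by have /asboolP[] := valP g. Qed.

Fact ratpts_mulA : associative ratpts_mul.
Proof. by move=> x y z; apply/val_inj; rewrite /= mulmxA. Qed.
Fact ratpts_mul1 : left_id ratpts_one ratpts_mul.
Proof. by move=> x; apply/val_inj; rewrite /= mul1mx. Qed.
Fact ratpts_1mul : right_id ratpts_one ratpts_mul.
Proof. by move=> x; apply/val_inj; rewrite /= mulmx1. Qed.
Fact ratpts_mulV : left_inverse ratpts_one ratpts_inv ratpts_mul.
Proof. by move=> x; apply/val_inj; rewrite /= mulVmx ?ratpts_unit. Qed.
Fact ratpts_Vmul : right_inverse ratpts_one ratpts_inv ratpts_mul.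
Proof. by move=> x; apply/val_inj; rewrite /= mulmxV ?ratpts_unit. Qed.
HB.instance Definition _ := isGroup.Build ratpts
  ratpts_mulA ratpts_mul1 ratpts_1mul ratpts_mulV ratpts_Vmul.
End RationalPoints.

(* When A and B are subgroups: A :&: B has finite index in A. *)
Definition fin_cover (G : groupType) (A B : set G) :=
  exists s : seq G, forall x, A x -> exists2 y, y \in s & B (y^-1 * x)%g.

Definition commensurable (G : groupType) (U V : subgroup G) :=
  fin_cover [set` U] [set` V] /\ fin_cover [set` V] [set` U].

Definition int_mx n (A : 'M[rat]_n) := forall i j, A i j \is a Num.int.

Section ArithmeticSubgroups.
Variables (n : nat) (G : algGroup n).

(* The kernel of reduction modulo N on G(Q) :&: GL_n(Z). *)
Definition principal_congruence (N : nat) : set (ratpts G) :=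
  [set g | [/\ int_mx (val g), int_mx (invmx (val g)) &
               int_mx (N%:R^-1 *: (val g - 1%:M))]].

Definition congruence_subgroup (U : subgroup (ratpts G)) :=
  exists N, [/\ (0 < N)%N, principal_congruence N `<=` [set` U] &
                fin_cover [set` U] (principal_congruence N)].

Definition arithmetic_subgroup (U : subgroup (ratpts G)) :=
  exists2 V, congruence_subgroup V & commensurable U V.
End ArithmeticSubgroups.
Arguments principal_congruence {n} G N _.
Arguments congruence_subgroup {n} G U.
Arguments arithmetic_subgroup {n} G U.

Section FiniteCovers.
Variable G : groupType.
Implicit Types A B C : set G.

Lemma fin_cover_classes (T : finType) (f : G -> T) A B :
  (forall x y, A x -> A y -> f x = f y -> B (x^-1 * y)%g) -> fin_cover A B.
Proof.
move=> h; pose r t := xget 1%g [set x | A x /\ f x = t].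
exists [seq r t | t : T] => x Ax; exists (r (f x)); first by apply/mapP; exists (f x); rewrite ?mem_enum.
have [Ar fr] : A (r (f x)) /\ f (r (f x)) = f x.
  by apply: (@xgetPex _ _ [set y | A y /\ f y = f x]); exists x.
exact: h.
Qed.

Lemma fin_cover_sub A A' B B' :
  A' `<=` A -> B `<=` B' -> fin_cover A B -> fin_cover A' B'.
Proof. by move=> AA BB [s h]; exists s => x /AA /h[y ys /BB]; exists y. Qed.

Lemma fin_cover_refl A B : A `<=` B -> fin_cover A B.
Proof.
by move=> AB; exists [:: 1%g] => x /AB Bx; exists 1%g; rewrite ?inE // invg1 mul1g.
Qed.

Lemma fin_cover_trans A B C : fin_cover A B -> fin_cover B C -> fin_cover A C.
Proof.
move=> [s hs] [s' hs']; exists [seq (y * z)%g | y <- s, z <- s'] => x /hs[y ys] /hs'[z zs' Cz].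
exists (y * z)%g; first by apply/allpairsP; exists (y, z).
by rewrite invgM -mulgA.
Qed.

Lemma fin_cover_conj (g : G) A B : fin_cover A B ->
  fin_cover [set x | A (g^-1 * x * g)%g] [set x | B (g^-1 * x * g)%g].
Proof.
move=> [s hs]; exists [seq (g * y * g^-1)%g | y <- s] => x /hs[y ys By].
exists (g * y * g^-1)%g; first exact: map_f.
rewrite /= !invgM invgK !mulgA mulVg mul1g.
by rewrite !mulgA in By *.
Qed.

Lemma subgroup_coset (U : subgroup G) (c x y : G) :
  (c^-1 * x)%g \in U -> (c^-1 * y)%g \in U -> (x^-1 * y)%g \in U.
Proof.
move=> hx hy; have -> : (x^-1 * y = (c^-1 * x)^-1 * (c^-1 * y))%g.
  by rewrite invgM invgK -mulgA mulVKg.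
by rewrite gpredM // gpredV.
Qed.

Lemma fin_cover_cap A (U V : subgroup G) :
  fin_cover A [set` U] -> fin_cover A [set` V] -> fin_cover A [set` capg U V].
Proof.
move=> [s hs] [s' hs'].
pose f x := (find (fun y => (y^-1 * x)%g \in U) s, find (fun y => (y^-1 * x)%g \in V) s').
pose f' x : 'I_(size s).+1 * 'I_(size s').+1 := (inord (f x).1, inord (f x).2).
apply: (@fin_cover_classes _ f') => x y Ax Ay e.
have hU t : A t -> ((nth 1%g s (f t).1)^-1 * t)%g \in U.
  move=> /hs[z zs zU]; apply: (nth_find 1%g (a := fun y => (y^-1 * t)%g \in U)).
  by apply/hasP; exists z.
have hV t : A t -> ((nth 1%g s' (f t).2)^-1 * t)%g \in V.
  move=> /hs'[z zs zU]; apply: (nth_find 1%g (a := fun y => (y^-1 * t)%g \in V)).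
  by apply/hasP; exists z.
have [e1 e2] : (f x).1 = (f y).1 /\ (f x).2 = (f y).2.
  move: e => [/(congr1 val) + /(congr1 val)].
  by rewrite /= !inordK // ltnS find_size.
apply/andP; split.
  by apply: (subgroup_coset (hU _ Ax)); rewrite e1; exact: hU.
by apply: (subgroup_coset (hV _ Ax)); rewrite e2; exact: hV.
Qed.
End FiniteCovers.

Section IntegralMatrices.
Variable n : nat.
Implicit Types A B : 'M[rat]_n.

Lemma int_mx1 : int_mx (1%:M : 'M[rat]_n).
Proof. by move=> i j; rewrite mxE; apply: rpredMn; exact: rpred1. Qed.
Lemma int_mxM A B : int_mx A -> int_mx B -> int_mx (A *m B).
Proof. by move=> hA hB i j; rewrite mxE; apply: rpred_sum => k _; exact: rpredM. Qed.
Lemma int_mxB A B : int_mx A -> int_mx B -> int_mx (A - B).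
Proof. by move=> hA hB i j; rewrite !mxE; exact: rpredB. Qed.
Lemma int_mxD A B : int_mx A -> int_mx B -> int_mx (A + B).
Proof. by move=> hA hB i j; rewrite !mxE; exact: rpredD. Qed.
Lemma int_mxZ (m : nat) A : int_mx A -> int_mx (m%:R *: A).
Proof. by move=> hA i j; rewrite !mxE; apply: rpredM => //; exact: rpred_nat. Qed.

Lemma int_mx_residue (N : nat) A B : (0 < N)%N -> int_mx A -> int_mx B ->
  (forall i j, (Num.floor (A i j) = Num.floor (B i j) %[mod N])%Z) ->
  int_mx (N%:R^-1 *: (B - A)).
Proof.
move=> N0 hA hB e i j; rewrite !mxE.
rewrite -(floorK (hA i j)) -(floorK (hB i j)) -rmorphB /=.
have /dvdzP[q ->] : (N %| Num.floor (B i j) - Num.floor (A i j))%Z.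
  by rewrite -eqz_mod_dvd; apply/eqP.
by rewrite rmorphM /= mulrC mulfK ?rpred_int // pnatr_eq0 -lt0n.
Qed.

Lemma int_mx_denom A : exists2 D : nat, (0 < D)%N & int_mx (D%:R *: A).
Proof.
exists (\prod_i \prod_j `|denq (A i j)|)%N.
  by rewrite prodn_gt0 // => i; rewrite prodn_gt0 // => j; rewrite absz_gt0 denq_neq0.
move=> i j; rewrite mxE.
have /dvdnP[q ->] : (`|denq (A i j)| %| \prod_k \prod_l `|denq (A k l)|)%N.
  by rewrite (bigD1 i) //= (bigD1 j) //= -mulnA dvdn_mulr.
rewrite natrM -mulrA [_%:R * A i j]mulrC.
have -> : A i j * `|denq (A i j)|%:R = (numq (A i j))%:~R :> rat.
  have -> : `|denq (A i j)|%:R = (denq (A i j))%:~R :> rat.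
    by rewrite -[in RHS]absz_denq pmulrn.
  by rewrite -numqE.
by apply: rpredM; rewrite ?rpred_int ?rpred_nat.
Qed.
End IntegralMatrices.

Section ArithmeticFamily.
Variables (n : nat) (G : algGroup n).
Local Notation Gam := (principal_congruence G).

Lemma valgM (g h : ratpts G) : val (g * h)%g = val g *m val h. Proof. by []. Qed.
Lemma valgV (g : ratpts G) : val (g^-1)%g = invmx (val g). Proof. by []. Qed.

Lemma Gam1E g : Gam 1 g <-> int_mx (val g) /\ int_mx (invmx (val g)).
Proof.
split=> [[]//|[h1 h2]]; split=> //; rewrite invr1 scale1r.
by apply: int_mxB => //; exact: int_mx1.
Qed.

Lemma Gam_sub M N : (0 < M)%N -> (0 < N)%N -> (M %| N)%N -> Gam N `<=` Gam M.
Proof.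
move=> M0 N0 /dvdnP[q e] g [h1 h2 h3]; split=> //.
have /(int_mxZ q) := h3; rewrite e scalerA natrM invfM.
rewrite mulrA mulfV ?mul1r // pnatr_eq0.
by apply: contraTneq N0 => q0; rewrite e q0.
Qed.

Definition int_closed_mem (g : ratpts G) := `[< Gam 1 g >].
Fact int_closed : group_closed (int_closed_mem : {pred ratpts G}).
Proof.
split=> [|x y /asboolP/Gam1E[hx hx'] /asboolP/Gam1E[hy hy']]; apply/asboolP/Gam1E.
  by split; rewrite /= ?invmx1; exact: int_mx1.
split; first exact: int_mxM.
by rewrite -valgV invgM invgK; exact: int_mxM.
Qed.
Definition int_points : subgroup (ratpts G) := Subgroup int_closed.

Lemma int_pointsE : [set` int_points] = Gam 1.
Proof. by apply/seteqP; split=> x /=; [move/asboolP | move=> h; apply/asboolP]. Qed.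

Lemma Gam_cover N : (0 < N)%N -> fin_cover (Gam 1) (Gam N).
Proof.
case: N => // N _.
pose f (g : ratpts G) : {ffun 'I_n * 'I_n -> 'I_N.+1} :=
  [ffun ij => inord `|(Num.floor (val g ij.1 ij.2) %% N.+1)%Z|].
apply: (@fin_cover_classes _ _ f) => x y /Gam1E[hx hx'] /Gam1E[hy hy'] e.
have r i j : (Num.floor (val x i j) = Num.floor (val y i j) %[mod N.+1])%Z.
  have /ffunP/(_ (i, j)) := e; rewrite !ffunE => /(congr1 val).
  have lt (z : int) : (`|(z %% N.+1)%Z| < N.+1)%N.
    by rewrite -ltz_nat gez0_abs ?modz_ge0 // ltz_pmod.
  rewrite /= !inordK // => /(congr1 Posz).
  by rewrite !gez0_abs ?modz_ge0.
have d := int_mx_residue (ltn0Sn N) hx hy r.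
split.
- exact: int_mxM.
- by rewrite -valgV invgM invgK; exact: int_mxM.
- have -> : val (x^-1 * y)%g - 1%:M = invmx (val x) *m (val y - val x).
    by rewrite mulmxBr mulVmx ?ratpts_unit.
  by rewrite scalemxAr; exact: int_mxM.
Qed.

Lemma Gam_conj (g : ratpts G) : exists2 N, (0 < N)%N &
  forall x, Gam N x -> Gam 1 (g^-1 * x * g)%g.
Proof.
have [D D0 hD] := int_mx_denom (val g).
have [E E0 hE] := int_mx_denom (invmx (val g)).
exists (E * D)%N; first by rewrite muln_gt0 E0.
have key (x : ratpts G) : int_mx ((E * D)%:R^-1 *: (val x - 1%:M)) ->
    int_mx (val (g^-1 * x * g)%g).
  move=> h; have := int_mxM hE (int_mxM h hD).
  rewrite -scalemxAl -scalemxAr -[X in _ *: X]scalemxAr.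
  rewrite -scalemxAl -scalemxAr !scalerA natrM.
  have -> : E%:R * (D%:R * (E%:R * D%:R)^-1) = 1 :> rat.
    by rewrite mulrCA mulrA mulrC [D%:R * _]mulrC mulVf // mulf_neq0 // pnatr_eq0 -lt0n.
  rewrite scale1r mulmxBl mulmxBr mul1mx mulVmx ?ratpts_unit // => h'.
  have := int_mxD h' (@int_mx1 n); rewrite subrK mulmxA.
  by [].
move=> x [h1 h2 h3]; apply/Gam1E; split; first exact: key.
rewrite -valgV !invgM invgK mulgA; apply: key.
have := int_mxM h2 h3; rewrite -scalemxAr mulmxBr mulmx1 mulVmx ?ratpts_unit //.
move=> h; have := int_mxB (A := 0) (B := _) _ h.
rewrite sub0r -scalerN opprB; apply=> i j.
by rewrite mxE rpred0.
Qed.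

Lemma congruence_commensurable U : congruence_subgroup G U ->
  fin_cover [set` U] (Gam 1) /\ fin_cover (Gam 1) [set` U].
Proof.
move=> [N [N0 NU UN]]; split.
  apply: (fin_cover_sub _ _ UN) => //; exact: Gam_sub.
by apply: (fin_cover_sub _ NU (Gam_cover N0)).
Qed.

Lemma int_points_congruence : congruence_subgroup G int_points.
Proof.
by exists 1%N; rewrite int_pointsE; split=> //; exact: fin_cover_refl.
Qed.

Lemma congruence_arithmetic U : congruence_subgroup G U -> arithmetic_subgroup G U.
Proof. by exists U => //; split; exact: fin_cover_refl. Qed.

Lemma arithmeticE U : arithmetic_subgroup G U <->
  fin_cover [set` U] (Gam 1) /\ fin_cover (Gam 1) [set` U].
Proof.
split=> [[V /congruence_commensurable[h1 h2] [h3 h4]]|h].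
  by split; [exact: fin_cover_trans h3 h1|exact: fin_cover_trans h2 h4].
exists int_points; first exact: int_points_congruence.
by rewrite /commensurable int_pointsE.
Qed.

Fact arithmetic_inhab : exists U, arithmetic_subgroup G U.
Proof. by exists int_points; apply/congruence_arithmetic/int_points_congruence. Qed.

Fact arithmetic_cap (U V : subgroup (ratpts G)) :
  arithmetic_subgroup G U -> arithmetic_subgroup G V -> arithmetic_subgroup G (capg U V).
Proof.
move=> /arithmeticE[hU Uh] /arithmeticE[hV Vh]; apply/arithmeticE; split.
  by apply: (fin_cover_sub _ _ hU) => // x /andP[].
exact: fin_cover_cap.
Qed.

Fact arithmetic_conj (g : ratpts G) (U : subgroup (ratpts G)) :
  arithmetic_subgroup G U -> arithmetic_subgroup G (conjsub g U).
Proof.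
have c (h : ratpts G) : fin_cover (Gam 1) [set x | Gam 1 (h^-1 * x * h)%g].
  have [N N0 hN] := Gam_conj h.
  exact: (fin_cover_sub _ hN (Gam_cover N0)).
move=> /arithmeticE[hU Uh]; apply/arithmeticE; split.
  apply: (fin_cover_trans (fin_cover_conj g hU)).
  have := fin_cover_conj g (c (g^-1)%g).
  apply: fin_cover_sub => // x; rewrite /= !mulgA invgK mulgV mul1g.
  by rewrite -!mulgA mulgV mulg1.
exact: (fin_cover_trans (c g) (fin_cover_conj g Uh)).
Qed.

Definition arithmetic_family : subgroup_family (ratpts G) :=
  SubgroupFamily arithmetic_inhab arithmetic_cap arithmetic_conj.

Definition arith_completion := completion arithmetic_family.
(* By strong approximation this completion is G(A_f). *)
Definition cong_completion := completion (congruence_subgroup G).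
Definition pr_cong : arith_completion -> cong_completion :=
  cpl_pr congruence_arithmetic.
Definition congruence_kernel : set arith_completion :=
  [set x | pr_cong x = cpl_one _].
End ArithmeticFamily.

(* Z/m for m > 0, including the trivial group for m = 1, where 'Z_m is Z/2. *)
Definition Zmod (m : nat) := 'I_(m.-1.+1).
HB.instance Definition _ m := GRing.Zmodule.on (Zmod m).

Section LAdic.
Variable l : nat.

Definition Zmod_red t (x : Zmod (l ^ t.+1)) : Zmod (l ^ t) := inZp (val x).

Fact Zmod_red_is_additive t : nmod_morphism (@Zmod_red t).
Proof.
have dvd : ((l ^ t).-1.+1 %| (l ^ t.+1).-1.+1)%N.
  have [->|l0] := posnP l; first by case: t => [|t]; rewrite ?expn0 !exp0n.
  by rewrite !prednK ?expn_gt0 ?l0 // dvdn_exp2l.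
split=> [|x y]; apply/val_inj; rewrite /= ?mod0n //.
by rewrite modn_dvdm // modnDm.
Qed.
HB.instance Definition _ t := GRing.isNmodMorphism.Build
  (Zmod (l ^ t.+1)) (Zmod (l ^ t)) (@Zmod_red t) (@Zmod_red_is_additive t).

Definition Zadic := invlim (fun t => @Zmod_red t : {additive _ -> _}).
HB.instance Definition _ := GRing.Zmodule.on Zadic.
End LAdic.

Section LAdicCohomology.
Variables (G : groupType) (F : subgroup_family G) (l : nat).

Definition Hbar2_Zl :=
  invlim (fun t => Hbar2_coef F (@Zmod_red l t) : {additive _ -> _}).
HB.instance Definition _ := GRing.Zmodule.on Hbar2_Zl.

Definition Hbar2_Zl_pr t (w : Hbar2_Zl) : Hbar2 F (Zmod (l ^ t)) := il_pr t w.

Fact cact_Zl_subproof (x : completion F) (w : Hbar2_Zl) t :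
  Hbar2_coef F (@Zmod_red l t) (cact x (Hbar2_Zl_pr t.+1 w)) = cact x (Hbar2_Zl_pr t w).
Proof. by rewrite cact_coef [Hbar2_coef _ _ _](il_coh w). Qed.
Definition cact_Zl (x : completion F) (w : Hbar2_Zl) : Hbar2_Zl :=
  il_mk (cact_Zl_subproof x w).

Definition invariants_Zl : set Hbar2_Zl := [set w | forall x, cact_Zl x w = w].

Definition virtually_lifts t (v : Hbar2 F (Zmod (l ^ t))) :=
  exists w : Hbar2_Zl, Hbar2_Zl_pr t w = v.
End LAdicCohomology.

Definition invariants (G : groupType) (F : subgroup_family G) (M : zmodType) :
  set (Hbar2 F M) := [set v | forall x : completion F, cact x v = v].

(* S is a subgroup of V isomorphic to W. *)
Definition subgroup_isomorphic (V : zmodType) (S : set V) (W : zmodType) :=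
  exists f : {additive W -> V}, injective f /\ range f = S.
Arguments invariants {G} F M.
Arguments invariants_Zl {G} F l.
Arguments congruence_kernel {n} G.

(* Main.v *)
(* Finite-index subgroups of arithmetic subgroups are arithmetic, so the direct limit of
   the groups Hom(Upsilon, Z/l^t) vanishes. The long exact sequences of
   0 -> Z/l^s -> Z/l^(s+t) -> Z/l^t -> 0 then give in the limit exact sequences
   0 -> Hbar2 (Z/l^s) -> Hbar2 (Z/l^(s+t)) -> Hbar2 (Z/l^t), and the inverse limit over s
   is the exact sequence 0 -> Hbar2 (Z_l) -- l^t --> Hbar2 (Z_l) -> Hbar2 (Z/l^t).
   Since Hbar2 (Z_l) has no l-torsion, w is invariant as soon as l^t w is; hence the
   kernel of reduction on the invariants I is l^t I, and the image of I is a copy of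
   I / l^t I = (Z/l^t)^c made of invariant classes that lift. *)
From HB Require Import structures.
From mathcomp Require Import all_boot all_order all_algebra all_field.
From mathcomp Require Import all_classical all_reals topology normedtype.
Require Import Defs.

Set Implicit Arguments.
Unset Strict Implicit.
Unset Printing Implicit Defensive.

Import GRing.Theory.

Local Open Scope classical_set_scope.
Local Open Scope ring_scope.

(** * Coboundaries at the level of cochains *)

Lemma H2map_eq0 (Gam Del : groupType) (M N : zmodType)
    (f : {multiplicative Del -> Gam}) (u : {additive M -> N}) (z : Z2 Gam M) :
  H2map f u (H2class z) = 0 <->
  exists p : Del -> N, forall x y,
    u (val z (f x) (f y)) = p y - p (x * y)%g + p x.
Proof.
rewrite H2mapE -(raddf0 (@H2class Del N)) H2class_eq subr0.
by split=> -[p hp]; exists p => x y; exact: hp.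
Qed.

Lemma coboundary2_cocycle (Gam : groupType) (M : zmodType) (f : Gam -> M) :
  is_cocycle2 (fun x y => f y - f (x * y)%g + f x).
Proof.
move=> x y z; apply/eqP; rewrite subr_eq0 addrAC subr_eq mulgA; apply/eqP.
rewrite [X in _ + X = _]addrAC addrA.
rewrite [X in X + (_ + _) - _]addrAC subrKA.
rewrite [X in _ = X + _]addrAC [X in _ = _ + X]addrC subrKA.
by rewrite [RHS]addrA -[f z + _ + _]addrA [f z + _]addrC.
Qed.

(** * Kernels of homomorphisms to an additive group, as finite-index subgroups *)

Section Kernel.
Variables (G : groupType) (U : subgroup G) (C : zmodType) (phi : subg U -> C).
Hypothesis phiM : forall x y, phi (x * y)%g = phi x + phi y.

(** The kernel is cut out inside [G], not inside [subg U], so that it can be a member of a family of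
    subgroups of [G]. *)
Definition kernel_mem (x : G) := `[< exists2 y : subg U, val y = x & phi y = 0 >].

Fact kernel_closed : group_closed (kernel_mem : {pred G}).
Proof.
have phi1 : phi 1%g = 0.
  by apply: (addrI (phi 1%g)); rewrite -phiM mulg1 addr0.
have phiV y : phi (y^-1)%g = - phi y.
  by apply: (addrI (phi y)); rewrite -phiM mulgV phi1 subrr.
split=> [|x x' /asboolP[y <- y0] /asboolP[y' <- y'0]]; apply/asboolP.
  by exists 1%g.
by exists (y / y')%g => //; rewrite phiM phiV y0 y'0 subrr.
Qed.
Definition kernel : subgroup G := Subgroup kernel_closed.

Lemma kernel_sub : {subset kernel <= U}.
Proof. by move=> x /asboolP[y <- _]; exact: valP. Qed.

Lemma kernelP (x : subg kernel) : phi (incl kernel_sub x) = 0.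
Proof.
have /asboolP[y e <-] := valP x.
by congr phi; apply/val_inj.
Qed.

Lemma mem_kernel (y : subg U) : phi y = 0 -> val y \in kernel.
Proof. by move=> y0; apply/asboolP; exists y. Qed.
End Kernel.

Lemma kernel_fin_cover (G : groupType) (U : subgroup G) (C : finZmodType)
    (phi : subg U -> C) (phiM : forall x y, phi (x * y)%g = phi x + phi y) :
  fin_cover [set` U] [set` kernel phiM].
Proof.
(* Classes are indexed by the values of [phi]; the default 0 outside [U] is harmless, as only
   elements of [U] are compared. *)
pose f x : C := if insub x is Some y then phi y else 0.
apply: (@fin_cover_classes _ _ f) => x y xU yU; rewrite /f.
rewrite (insubT (mem U) xU) (insubT (mem U) yU) /= => e.
have := @mem_kernel _ _ _ _ phiM (((Sub x xU : subg U)^-1) * (Sub y yU : subg U))%g.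
rewrite phiM -e -phiM mulVg; apply.
by apply: (addrI (phi 1%g)); rewrite -phiM mulg1 addr0.
Qed.

(** This closure makes the direct limit of the groups Hom(U, C) vanish for finite [C]. *)
Definition finite_index_closed (G : groupType) (P : subgroup G -> Prop) :=
  forall U V : subgroup G, P U -> {subset V <= U} -> fin_cover [set` U] [set` V] -> P V.

Lemma arithmetic_finite_index_closed n (G : algGroup n) :
  finite_index_closed (arithmetic_subgroup G).
Proof.
move=> U V /arithmeticE[hU Uh] VU UV; apply/arithmeticE; split.
  exact: fin_cover_sub hU.
exact: fin_cover_trans Uh UV.
Qed.

(** * Exactness of [Hbar2] in the coefficients *)

Section ExactSequence.
Variables (G : groupType) (F : subgroup_family G) (A B C : zmodType).
Variables (i : {additive A -> B}) (p : {additive B -> C}).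
Hypotheses (i_inj : injective i) (p_surj : forall c, exists b, p b = c).
Hypothesis (ker_p : forall b, p b = 0 -> exists a, i a = b).

Lemma Hbar2_in_eq0 (M : zmodType) (U : fam_index F) (a : H2 (subg (sval U)) M) :
  Hbar2_in a = 0 <-> exists V (h : H2_le U V), H2_res M h a = 0.
Proof.
split=> [|[V [h e]]]; last by rewrite -(Hbar2_in_res h) e raddf0.
rewrite -[0](raddf0 (@Hbar2_in _ _ M U)) => /(dl_in_eq (A := H2_system F M)).
move=> [V [h [h' e]]]; exists V, h.
by rewrite [LHS]e raddf0.
Qed.

(** Over a small enough [V], the image of the cocycle under [p] is the coboundary of some [f].
    Lifting [f] to a [B]-valued cochain and subtracting its coboundary leaves a cocycle with values
    in the image of [i]. *)
Lemma Hbar2_coef_exact (v : Hbar2 F B) :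
  Hbar2_coef F p v = 0 -> exists u, Hbar2_coef F i u = v.
Proof.
have [U [a ->]] := Hbar2_surj v; rewrite Hbar2_coefE => /Hbar2_in_eq0[V [h]].
have [z ->] := H2class_surj a.
rewrite [X in X = _](H2map_comp (h := incl h) (w := p)) // => /H2map_eq0[f hf].
(* [s] is a set-theoretic section of [p]. *)
have [s hs] := choice (fun c => p_surj c).
pose fb x := s (f x).
pose zb x y := val z (incl h x) (incl h y) - (fb y - fb (x * y)%g + fb x).
have hz x y : exists a, i a = zb x y.
  by apply: ker_p; rewrite raddfB hf raddfD raddfB /= !hs subrr.
have [za' hza'] := choice (fun xy : subg (sval V) * subg (sval V) => hz xy.1 xy.2).
pose za x y := za' (x, y).
have hza x y : i (za x y) = zb x y := hza' (x, y).
have zaP : za \in @cocycle2 (subg (sval V)) A.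
  apply/asboolP => x y w; apply: i_inj.
  rewrite raddf0 raddfB raddfD raddfB !hza /zb.
  have /asboolP/(_ (incl h x) (incl h y) (incl h w)) := valP z.
  have := coboundary2_cocycle fb x y w.
  rewrite -!gmulfM subr_ACA => e1 e2.
  rewrite [X in X - _]addrACA -opprD subr_ACA.
  by rewrite e1 e2 subrr.
exists (Hbar2_in (H2class (exist _ za zaP))).
rewrite Hbar2_coefE -(Hbar2_in_res h); congr Hbar2_in.
rewrite [LHS]H2mapE [RHS]H2mapE; apply/H2class_eq.
exists (fun x => - fb x) => x y /=.
rewrite -[LHS]/(i (za x y) - val z (incl h x) (incl h y)) hza.
by rewrite /zb addrC addKr !opprD opprK.
Qed.

End ExactSequence.

(** The kernel at a finite level comes from the connecting map out of Hom(V, C). If the image of [z]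
    under [i] is the coboundary of [f], then [p \o f] is a homomorphism to a finite group; on its
    kernel [f] takes values in the image of [i], so [z] becomes a coboundary there. *)
Lemma Hbar2_coef_inj (G : groupType) (F : subgroup_family G)
    (A B : zmodType) (C : finZmodType) (i : {additive A -> B}) (p : {additive B -> C}) :
  finite_index_closed F -> injective i -> (forall a, p (i a) = 0) ->
  (forall b, p b = 0 -> exists a, i a = b) ->
  injective (Hbar2_coef F i).
Proof.
move=> F_closed i_inj pi0 ker_p; apply: raddf_inj => u.
have [U [a ->]] := Hbar2_surj u; rewrite [X in X = _]Hbar2_coefE => /Hbar2_in_eq0[V [h]].
have [z ->] := H2class_surj a.
rewrite [X in X = _](H2map_comp (h := incl h) (w := i)) // => /H2map_eq0[f hf].
have pfM x y : p (f (x * y)%g) = p (f x) + p (f y).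
  have := congr1 p (hf x y); rewrite pi0 raddfD raddfB => /esym/eqP.
  by rewrite addrAC subr_eq0 addrC => /eqP.
pose W : fam_index F := exist _ (kernel pfM)
  (F_closed _ _ (svalP V) (@kernel_sub _ _ _ _ pfM) (kernel_fin_cover pfM)).
have hW : H2_le V W := @kernel_sub _ _ _ _ pfM.
have [f' hf'] := choice (fun x : subg (sval W) => ker_p _ (kernelP x)).
apply/Hbar2_in_eq0; exists W, (H2_le_trans h hW).
apply/H2map_eq0; exists f' => x y; apply: i_inj.
rewrite raddfD raddfB !hf' !gmulfM.
rewrite -hf /=; congr (i (val z _ _)); exact/val_inj.
Qed.

(** * Functoriality in the coefficients and additivity of the action *)

Section Coefficients.
Variables (G : groupType) (F : subgroup_family G).

Lemma Hbar2_coef_comp (M N P : zmodType) (u : {additive M -> N})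
    (v : {additive N -> P}) (w : {additive M -> P}) :
  w =1 v \o u -> forall a, Hbar2_coef F v (Hbar2_coef F u a) = Hbar2_coef F w a.
Proof.
move=> e a; have [U [b ->]] := Hbar2_surj a; rewrite !Hbar2_coefE.
by congr Hbar2_in; apply: H2map_comp.
Qed.

Lemma Hbar2_coefMn (M : zmodType) (u : {additive M -> M}) k :
  (forall x, u x = x *+ k) -> forall a, Hbar2_coef F u a = a *+ k.
Proof.
move=> e a; have [U [b ->]] := Hbar2_surj a; have [z ->] := H2class_surj b.
rewrite Hbar2_coefE /H2_coef [X in Hbar2_in X]H2mapE -!raddfMn; congr (Hbar2_in (H2class _)).
apply/val_inj/funext => x; apply/funext => y; rewrite /= e.
elim: k {e} => [|k IH]; first by rewrite !mulr0n.
by rewrite !mulrS -[RHS]/(val z x y + val (z *+ k) x y) IH.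
Qed.

Lemma cact_is_additive (M : zmodType) (x : completion F) :
  zmod_morphism (@cact G F M x).
Proof.
move=> a b; have [U [a' [b' [-> ->]]]] := Hbar2_surj2 a b.
have [g hg] := cpl_nonempty x U.
by rewrite -raddfB !(cactE _ hg) !raddfB.
Qed.
HB.instance Definition _ (M : zmodType) (x : completion F) :=
  GRing.isZmodMorphism.Build (Hbar2 F M) (Hbar2 F M) (cact x) (cact_is_additive x).
End Coefficients.

(** * Maps between cyclic groups *)

Section ZmodScale.
Variables (m n k : nat) (dvd : (n.-1.+1 %| k * m.-1.+1)%N).

(* Covers the reduction Z/l^(s+t) -> Z/l^t (k = 1), the embedding
   Z/l^s -> Z/l^(s+t) (k = l^t) and multiplication by k on Z/m. *)
Definition Zmod_scale (x : Zmod m) : Zmod n := inZp (k * nat_of_ord x).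

(** Multiplication by [k] is well defined from Z/m to Z/n because [n] divides [k * m]. *)
Fact Zmod_scale_is_additive : nmod_morphism Zmod_scale.
Proof using dvd.
split=> [|x y]; apply/val_inj; rewrite /= ?muln0 ?mod0n //.
by rewrite modnDm -mulnDr muln_modr modn_dvdm.
Qed.
Definition Zmod_scale_additive : {additive Zmod m -> Zmod n} :=
  HB.pack Zmod_scale
    (GRing.isNmodMorphism.Build (Zmod m) (Zmod n) Zmod_scale Zmod_scale_is_additive).
End ZmodScale.

HB.instance Definition _ m := Finite.on (Zmod m).

Lemma Zmod_lt m (x : Zmod m) : (0 < m)%N -> (nat_of_ord x < m)%N.
Proof. by move=> h; rewrite -[X in (_ < X)%N](prednK h); exact: ltn_ord. Qed.

Lemma Zmod_scaleE m n k (x : Zmod m) : (0 < n)%N ->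
  nat_of_ord (@Zmod_scale m n k x) = (k * nat_of_ord x %% n)%N.
Proof. by move=> h; rewrite -[X in (_ %% X)%N](prednK h). Qed.

Section ZmodExact.
Variables (K m n : nat) (m_gt0 : (0 < m)%N) (n_gt0 : (0 < n)%N) (eK : K = (n * m)%N).

Let K_gt0 : (0 < K)%N. Proof. by rewrite eK muln_gt0 n_gt0. Qed.

(** The four lemmas of this section give the exactness of 0 -> Z/m -- n --> Z/K -> Z/n -> 0. *)
Lemma Zmod_scale_inj : injective (@Zmod_scale m K n).
Proof using K_gt0 m_gt0 n_gt0 eK.
move=> x y /(congr1 (@nat_of_ord _)); rewrite !Zmod_scaleE //.
have lt (z : Zmod m) : (n * nat_of_ord z < K)%N by rewrite eK ltn_pmul2l // Zmod_lt.
rewrite !modn_small //.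
by move=> /eqP; rewrite eqn_pmul2l // => /eqP/val_inj.
Qed.

Lemma Zmod_scale_scale (x : Zmod m) : @Zmod_scale K n 1 (@Zmod_scale m K n x) = 0.
Proof using K_gt0 m_gt0 n_gt0 eK.
apply/val_inj; rewrite [LHS]Zmod_scaleE // Zmod_scaleE // mul1n.
by rewrite modn_dvdm ?modnMr // eK dvdn_mulr.
Qed.

Lemma Zmod_scale_surj (y : Zmod n) : exists x, @Zmod_scale K n 1 x = y.
Proof using K_gt0 m_gt0 n_gt0 eK.
exists (@Zmod_scale n K 1 y); apply/val_inj; rewrite [LHS]Zmod_scaleE // Zmod_scaleE //.
by rewrite !mul1n modn_dvdm ?modn_small ?Zmod_lt // eK dvdn_mulr.
Qed.

Lemma Zmod_scale_ker (x : Zmod K) :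
  @Zmod_scale K n 1 x = 0 -> exists y, @Zmod_scale m K n y = x.
Proof using K_gt0 m_gt0 n_gt0 eK.
move=> /(congr1 (@nat_of_ord _)); rewrite Zmod_scaleE // mul1n => /eqP.
rewrite -/(dvdn _ _) => /dvdnP[q e].
have x_lt := Zmod_lt x K_gt0.
have q_lt : (q < m)%N by rewrite -(ltn_pmul2l n_gt0) -eK mulnC -e.
have e' : nat_of_ord (inZp q : Zmod m) = q by rewrite /= (prednK m_gt0) modn_small.
exists (inZp q); apply/val_inj; rewrite [LHS]Zmod_scaleE // e'.
by rewrite mulnC -e modn_small.
Qed.
End ZmodExact.

Lemma Zmod_mulrn m k (x : Zmod m) : x *+ k = Zmod_scale m k x.
Proof. by rewrite [LHS]Zp_mulrn /Zmod_scale mulnC. Qed.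

Lemma Hbar2_Zmod_mulrn (G : groupType) (F : subgroup_family G) m
    (a : Hbar2 F (Zmod m)) : (0 < m)%N -> a *+ m = 0.
Proof.
move=> m_gt0; pose z0 : {additive Zmod m -> Zmod m} := \0.
(* The zero map of Z/m is both multiplication by [m] and multiplication by 0. *)
rewrite -(Hbar2_coefMn (u := z0)) ?(Hbar2_coefMn (u := z0) (k := 0)) // => x.
by rewrite Zmod_mulrn; apply/val_inj; rewrite [RHS]Zmod_scaleE // modnMr.
Qed.

Fact Hbar2_Zl_pr_is_additive (G : groupType) (F : subgroup_family G) l t :
  zmod_morphism (@Hbar2_Zl_pr G F l t).
Proof. by []. Qed.
HB.instance Definition _ (G : groupType) (F : subgroup_family G) l t :=
  GRing.isZmodMorphism.Build (Hbar2_Zl F l) (Hbar2 F (Zmod (l ^ t)))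
    (@Hbar2_Zl_pr G F l t) (@Hbar2_Zl_pr_is_additive G F l t).

(** * Torsion and reduction in [l]-adic cohomology *)

Section LAdicCohomology.
Variables (G : groupType) (F : subgroup_family G) (l : nat).
Hypotheses (F_closed : finite_index_closed F) (l_gt0 : (0 < l)%N).
Implicit Types w : Hbar2_Zl F l.

Let l_exp s : (0 < l ^ s)%N. Proof. by rewrite expn_gt0 l_gt0. Qed.

Fact Zmod_red_dvd a b : (b <= a)%N -> ((l ^ b).-1.+1 %| 1 * (l ^ a).-1.+1)%N.
Proof using l_gt0. by move=> h; rewrite mul1n !prednK // dvdn_exp2l. Qed.

Fact Zmod_mul_dvd s t : ((l ^ (s + t)).-1.+1 %| l ^ t * (l ^ s).-1.+1)%N.
Proof using l_gt0. by rewrite !prednK // expnD mulnC. Qed.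

Let red a b (h : (b <= a)%N) : {additive Zmod (l ^ a) -> Zmod (l ^ b)} :=
  Zmod_scale_additive (Zmod_red_dvd h).
Let mul s t : {additive Zmod (l ^ s) -> Zmod (l ^ (s + t))} :=
  Zmod_scale_additive (Zmod_mul_dvd s t).

Let exp_split s t : (l ^ (s + t) = l ^ t * l ^ s)%N.
Proof. by rewrite expnD mulnC. Qed.

Lemma Zmod_redE s (x : Zmod (l ^ s.+1)) :
  nat_of_ord (Zmod_red x) = (nat_of_ord x %% l ^ s)%N.
Proof using l_gt0. by rewrite -[X in (_ %% X)%N](prednK (l_exp s)). Qed.

Lemma Hbar2_Zl_coh w s :
  Hbar2_coef F (@Zmod_red l s) (Hbar2_Zl_pr s.+1 w) = Hbar2_Zl_pr s w.
Proof. exact: il_coh w s. Qed.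

Lemma Hbar2_Zl_pr_red w a b (h : (b <= a)%N) :
  Hbar2_coef F (red h) (Hbar2_Zl_pr a w) = Hbar2_Zl_pr b w.
Proof using l_gt0.
elim: a h => [|a IH] h.
  case: b h => // h.
  rewrite (Hbar2_coefMn (k := 1)) // => x.
  by apply/val_inj; rewrite [LHS]Zmod_scaleE // mul1n modn_small // Zmod_lt.
have [e|lt] := eqVneq b a.+1.
  (* The reduction from a level to itself is multiplication by 1. *)
  rewrite {}e in h *; rewrite (Hbar2_coefMn (k := 1)) // => x.
  by apply/val_inj; rewrite [LHS]Zmod_scaleE // mul1n modn_small // Zmod_lt.
have h' : (b <= a)%N by rewrite -ltnS ltn_neqAle lt.
rewrite -(IH h') -[in RHS](Hbar2_Zl_coh w a).
rewrite (Hbar2_coef_comp (w := red h)) // => x.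
apply/val_inj; rewrite [RHS]Zmod_scaleE // [LHS]Zmod_scaleE // Zmod_redE.
by rewrite !mul1n modn_dvdm // dvdn_exp2l.
Qed.

Lemma Hbar2_mul_inj s t : injective (Hbar2_coef F (mul s t)).
Proof using F_closed l_gt0.
apply: (Hbar2_coef_inj (p := red (leq_addl s t)) F_closed).
- exact: Zmod_scale_inj (exp_split s t).
- exact: Zmod_scale_scale (exp_split s t).
- exact: Zmod_scale_ker (exp_split s t).
Qed.

(** On Z/l^(s+t), multiplication by l^t is reduction to Z/l^s followed by the embedding [mul s t].
    Hence [mul s t] kills the component of [w] at level [s], and it is injective on [Hbar2]. *)
Lemma Hbar2_Zl_torsion_free t w : w *+ (l ^ t) = 0 -> w = 0.
Proof using F_closed l_gt0.
move=> e; apply: invlimP => s; apply: (@Hbar2_mul_inj s t).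
rewrite [RHS]raddf0 -[X in Hbar2_coef _ _ X](Hbar2_Zl_pr_red w (leq_addr t s)).
rewrite (Hbar2_coef_comp (w := mul s t \o red (leq_addr t s))) //.
rewrite (Hbar2_coefMn (k := l ^ t)); last first.
  move=> x; rewrite Zmod_mulrn; apply/val_inj.
  rewrite [RHS]Zmod_scaleE // [LHS]Zmod_scaleE // Zmod_scaleE // mul1n.
  by rewrite muln_modr -exp_split modn_mod.
by rewrite -raddfMn e raddf0.
Qed.

(** Since the component at level [t] vanishes, exactness gives a preimage of the component at level
    [s + t] under [mul s t]; these preimages form the required [w']. *)
Lemma Hbar2_Zl_ker_pr t w : Hbar2_Zl_pr t w = 0 -> exists w', w = w' *+ (l ^ t).
Proof using F_closed l_gt0.
move=> w0.
have ex s : exists u, Hbar2_coef F (mul s t) u = Hbar2_Zl_pr (s + t) w.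
  apply: (Hbar2_coef_exact (p := red (leq_addl s t))).
  - exact: Zmod_scale_inj (exp_split s t).
  - exact: Zmod_scale_surj (exp_split s t).
  - exact: Zmod_scale_ker (exp_split s t).
  - by rewrite Hbar2_Zl_pr_red.
pose u s := sval (cid (ex s)).
have hu s : Hbar2_coef F (mul s t) (u s) = Hbar2_Zl_pr (s + t) w := svalP (cid (ex s)).
(* Injectivity of [mul s t] makes the preimages unique, hence compatible. *)
have u_coh s : Hbar2_coef F (@Zmod_red l s) (u s.+1) = u s.
  apply: (@Hbar2_mul_inj s t); rewrite hu -(Hbar2_Zl_coh w (s + t)).
  rewrite -[Hbar2_Zl_pr _ _](hu s.+1).
  rewrite (Hbar2_coef_comp (w := mul s t \o @Zmod_red l s)) //.
  rewrite (Hbar2_coef_comp (w := mul s t \o @Zmod_red l s)) // => x.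
  apply/val_inj; rewrite [LHS]Zmod_scaleE // [RHS]Zmod_redE Zmod_redE.
  rewrite [X in _ = (X %% _)%N]Zmod_scaleE //.
  by rewrite muln_modr -exp_split modn_mod modn_dvdm // dvdn_exp2l.
(* Embedding Z/l^s into Z/l^(s+t) and reducing back is multiplication by l^t. *)
exists (il_mk u_coh); apply: invlimP => s; rewrite [RHS]raddfMn.
rewrite -[LHS](Hbar2_Zl_pr_red w (leq_addr t s)) -hu.
rewrite (Hbar2_coef_comp (w := red (leq_addr t s) \o mul s t)) //.
rewrite (Hbar2_coefMn (k := l ^ t)) // => x.
rewrite Zmod_mulrn; apply/val_inj.
rewrite [RHS]Zmod_scaleE // [LHS]Zmod_scaleE // Zmod_scaleE // mul1n.
by rewrite modn_dvdm // dvdn_exp2l // leq_addr.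
Qed.

Fact Zadic_one_subproof s : @Zmod_red l s (inZp 1) = inZp 1.
Proof using l_gt0.
apply/val_inj; rewrite [LHS]Zmod_redE /= !prednK // modn_dvdm // dvdn_exp2l //.
Qed.
Definition Zadic_one : Zadic l := il_mk Zadic_one_subproof.

Lemma il_pr_Zadic_one t k :
  nat_of_ord (il_pr t (Zadic_one *+ k) : Zmod (l ^ t)) = (k %% l ^ t)%N.
Proof using l_gt0.
rewrite raddfMn Zmod_mulrn Zmod_scaleE //= prednK //.
by rewrite modnMmr muln1.
Qed.

(** The difference between [w] and its translate by [x] is killed by l^t, hence is zero. *)
Lemma invariants_Zl_pure w t : invariants_Zl F l (w *+ (l ^ t)) -> invariants_Zl F l w.
Proof using F_closed l_gt0.
move=> h x; apply/eqP; rewrite -subr_eq0; apply/eqP.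
apply: (@Hbar2_Zl_torsion_free t); rewrite mulrnBl -[X in _ - X](h x).
apply/eqP; rewrite subr_eq0; apply/eqP/invlimP => s.
rewrite [LHS]raddfMn -[LHS](raddfMn (cact x)).
by congr cact; rewrite -raddfMn.
Qed.

Lemma invariants_Zl_reduction t c :
  subgroup_isomorphic (invariants_Zl F l) 'rV[Zadic l]_c ->
  exists S : set (Hbar2 F (Zmod (l ^ t))),
    [/\ S `<=` invariants F (Zmod (l ^ t)),
        subgroup_isomorphic S 'rV[Zmod (l ^ t)]_c &
        forall v, S v -> virtually_lifts v].
Proof using F_closed l_gt0.
move=> [f [f_inj f_range]].
have f_inv x : invariants_Zl F l (f x) by rewrite -f_range; exists x.
(* Entries are lifted through their representatives in [0, l^t); [lift] is not additive, but becomes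
   so after reduction. *)
pose lift (v : 'rV[Zmod (l ^ t)]_c) : 'rV[Zadic l]_c :=
  \row_j (Zadic_one *+ nat_of_ord (v 0 j)).
pose g v := Hbar2_Zl_pr t (f (lift v)).
have g_add : nmod_morphism g.
  split=> [|v v']; rewrite /g.
    have -> : lift 0 = 0 by apply/rowP => j; rewrite !mxE mulr0n.
    by rewrite !raddf0.
  (* [q] records the carries: the defect of additivity of [lift] is l^t times [q], which dies in
     [Hbar2] of Z/l^t. *)
  pose q : 'rV[Zadic l]_c :=
    \row_j (Zadic_one *+ ((nat_of_ord (v 0 j) + nat_of_ord (v' 0 j)) %/ l ^ t)).
  have e : lift v + lift v' = q *+ (l ^ t) + lift (v + v').
    apply/rowP => j; rewrite !mxE -mulrnDr.
    rewrite mulmxnE mxE -mulrnA -mulrnDr; congr (_ *+ _).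
    rewrite [LHS](divn_eq _ (l ^ t)); congr addn.
    by rewrite -[X in (_ %% X)%N](prednK (l_exp t)).
  rewrite -[RHS]raddfD -raddfD e !raddfD !raddfMn.
  by rewrite Hbar2_Zmod_mulrn // add0r.
pose gA : {additive 'rV[Zmod (l ^ t)]_c -> Hbar2 F (Zmod (l ^ t))} :=
  HB.pack g (GRing.isNmodMorphism.Build _ _ g g_add).
exists (range g); split.
- move=> _ [v _ <-] x; rewrite /g.
  by rewrite -[in RHS](f_inv (lift v) x).
- exists gA; split=> //; apply: raddf_inj => v /Hbar2_Zl_ker_pr[w e].
  (* Purity brings [w] back into the range of [f], so [lift v] is divisible by l^t in Z_l^c; at
     level [t] this forces every entry of [v] to vanish. *)
  have : invariants_Zl F l w by apply: (@invariants_Zl_pure _ t); rewrite -e.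
  rewrite -f_range => -[y _ fy].
  have ey : lift v = y *+ (l ^ t) by apply: f_inj; rewrite raddfMn fy.
  apply/rowP => j; apply/val_inj.
  rewrite [X in _ = \val X]mxE -[LHS](modn_small (Zmod_lt _ (l_exp t))) -il_pr_Zadic_one.
  have -> : Zadic_one *+ nat_of_ord (v 0 j) = (y 0 j) *+ (l ^ t).
    by have /rowP/(_ j) := ey; rewrite mxE mulmxnE.
  by rewrite raddfMn Zmod_mulrn Zmod_scaleE // modnMr.
- by move=> _ [v _ <-]; exists (f (lift v)).
Qed.
End LAdicCohomology.

Theorem corollary3 (R : realType) (n : nat) (G : algGroup n)
    (G_simple : simple_group G)
    (G_simply_connected : simply_connected G)
    (G_real_rank : positive_real_rank R G)
    (Cong_finite : finite_set (congruence_kernel G))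
    (l : nat) (l_prime : prime l) (t : nat) (t_gt0 : (0 < t)%N)
    (c : nat) (c_gt0 : (0 < c)%N)
    (c_rank : subgroup_isomorphic
                (invariants_Zl (arithmetic_family G) l)
                'rV[Zadic l]_c) :
  exists S : set (Hbar2 (arithmetic_family G) (Zmod (l ^ t))),
    [/\ S `<=` invariants (arithmetic_family G) (Zmod (l ^ t)),
        subgroup_isomorphic S 'rV[Zmod (l ^ t)]_c &
        forall v, S v -> virtually_lifts v].
Proof.
apply: invariants_Zl_reduction c_rank; last exact: prime_gt0.
exact: arithmetic_finite_index_closed.
Qed.
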